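(* The category of finite strict double posets is $(\mathrm{RegEpi},\mathrm{Mono})$-structured and $(\mathrm{Epi},\mathrm{RegMono})$-structured.
   Context: A finite strict double poset is a triple $(A,P_A,Q_A)$ with $A$ finite and $P_A,Q_A$ strict partial orders on $A$; morphisms are maps preserving both strict orders. $\mathrm{Mono},\mathrm{Epi}$ are the classes of monomorphisms and epimorphisms; $\mathrm{RegMono}$ the class of regular monomorphisms (equalizers of some parallel pair), $\mathrm{RegEpi}$ the class of regular epimorphisms (coequalizers of some parallel pair). For classes $E,M$ of morphisms, a category is $(E,M)$-structured if (1) $E$ and $M$ are closed under composition with isomorphisms; (2) every morphism $f$ factors as $f=m\circ e$ with $e\in E$, $m\in M$; (3) for every commutative square $g\circ e=m\circ f$ with $e\in E$, $m\in M$ there is a unique morphism $d$ with $d\circ e=f$ and $m\circ d=g$. *)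

(* Defs.v *)
From HB Require Import structures.
From mathcomp Require Import all_boot.

Set Implicit Arguments.
Unset Strict Implicit.
Unset Printing Implicit Defensive.

Record category := Category {
  obj :> Type;
  hom : obj -> obj -> Type;
  idm : forall a, hom a a;
  cmp : forall a b c, hom b c -> hom a b -> hom a c;
  cmp1m : forall a b (f : hom a b), cmp (idm b) f = f;
  cmpm1 : forall a b (f : hom a b), cmp f (idm a) = f;
  cmpA : forall a b c d (h : hom c d) (g : hom b c) (f : hom a b),
    cmp h (cmp g f) = cmp (cmp h g) f
}.

Arguments hom {c} a b : rename.
Arguments idm {c} a : rename.
Arguments cmp {c a0 b c0} g f : rename.

Declare Scope cat_scope.
Delimit Scope cat_scope with cat.
Notation "g \c f" := (cmp g f) (at level 40, left associativity) : cat_scope.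
Local Open Scope cat_scope.

Definition mor_class (C : category) := forall a b : C, hom a b -> Prop.

Definition Iso (C : category) : mor_class C := fun a b f =>
  exists g : hom b a, g \c f = idm a /\ f \c g = idm b.

Definition Mono (C : category) : mor_class C := fun a b f =>
  forall (x : C) (g h : hom x a), f \c g = f \c h -> g = h.

Definition Epi (C : category) : mor_class C := fun a b f =>
  forall (x : C) (g h : hom b x), g \c f = h \c f -> g = h.

Definition is_equalizer (C : category) (a b x : C)
    (g h : hom b x) (f : hom a b) : Prop :=
  g \c f = h \c f /\
  forall (y : C) (k : hom y b), g \c k = h \c k ->
    exists! u : hom y a, f \c u = k.

Definition is_coequalizer (C : category) (x a b : C)
    (g h : hom x a) (f : hom a b) : Prop :=
  f \c g = f \c h /\
  forall (y : C) (k : hom a y), k \c g = k \c h ->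
    exists! u : hom b y, u \c f = k.

Definition RegMono (C : category) : mor_class C := fun a b f =>
  exists (x : C) (g h : hom b x), is_equalizer g h f.

Definition RegEpi (C : category) : mor_class C := fun a b f =>
  exists (x : C) (g h : hom x a), is_coequalizer g h f.

Definition iso_closed (C : category) (E : mor_class C) : Prop :=
  (forall (a b c : C) (f : hom a b) (h : hom b c),
     E a b f -> Iso h -> E a c (h \c f)) /\
  (forall (a b c : C) (h : hom a b) (f : hom b c),
     Iso h -> E b c f -> E a c (f \c h)).

Definition has_factorizations (C : category) (E M : mor_class C) : Prop :=
  forall (a b : C) (f : hom a b),
    exists (c : C) (e : hom a c) (m : hom c b),
      [/\ E a c e, M c b m & f = m \c e].

Definition has_unique_diagonals (C : category) (E M : mor_class C) : Prop :=
  forall (a b c d : C) (e : hom a b) (m : hom c d) (f : hom a c) (g : hom b d),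
    E a b e -> M c d m -> g \c e = m \c f ->
    exists! k : hom b c, k \c e = f /\ m \c k = g.

Definition structured (C : category) (E M : mor_class C) : Prop :=
  [/\ iso_closed E /\ iso_closed M,
      has_factorizations E M
    & has_unique_diagonals E M].

Definition strict_order (T : Type) (R : rel T) : Prop :=
  irreflexive R /\ transitive R.

Record dposet := DPoset {
  dp_carrier :> finType;
  dp_ltP : rel dp_carrier;
  dp_ltQ : rel dp_carrier;
  dp_ltP_strict : strict_order dp_ltP;
  dp_ltQ_strict : strict_order dp_ltQ
}.

Definition dp_monotone (A B : dposet) (f : A -> B) : bool :=
  [forall x, forall y, (dp_ltP x y ==> dp_ltP (f x) (f y)) &&
                       (dp_ltQ x y ==> dp_ltQ (f x) (f y))].

Lemma dp_monotoneP (A B : dposet) (f : A -> B) :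
  reflect ({homo f : x y / dp_ltP x y} /\ {homo f : x y / dp_ltQ x y})
          (dp_monotone f).
Proof.
apply: (iffP forallP) => [fM|[fP fQ] x].
  by split=> x y; have /forallP/(_ y)/andP[/implyP fP /implyP fQ] := fM x.
by apply/forallP=> y; apply/andP; split; apply/implyP; [apply: fP|apply: fQ].
Qed.

(* Finite functions and a boolean monotonicity proof make Leibniz equality of
   morphisms coincide with pointwise equality of maps. *)
Record dp_hom (A B : dposet) := DPHom {
  dp_fun :> {ffun A -> B};
  dp_funP : dp_monotone dp_fun
}.

HB.instance Definition _ (A B : dposet) := [isSub for @dp_fun A B].

Lemma dp_homP (A B : dposet) (f g : dp_hom A B) : f =1 g <-> f = g.
Proof. by split=> [fg|-> //]; apply/val_inj/ffunP. Qed.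

Lemma dp_id_subproof (A : dposet) : dp_monotone [ffun x : A => x].
Proof. by apply/dp_monotoneP; split=> x y; rewrite !ffunE. Qed.

Definition dp_id (A : dposet) : dp_hom A A := DPHom (dp_id_subproof A).

Lemma dp_comp_subproof (A B C : dposet) (g : dp_hom B C) (f : dp_hom A B) :
  dp_monotone [ffun x => g (f x)].
Proof.
have [gP gQ] := dp_monotoneP _ (dp_funP g).
have [fP fQ] := dp_monotoneP _ (dp_funP f).
by apply/dp_monotoneP; split=> x y xy; rewrite !ffunE;
  [apply/gP/fP|apply/gQ/fQ].
Qed.

Definition dp_comp (A B C : dposet) (g : dp_hom B C) (f : dp_hom A B) :
  dp_hom A C := DPHom (dp_comp_subproof g f).

Lemma dp_comp1m (A B : dposet) (f : dp_hom A B) : dp_comp (dp_id B) f = f.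
Proof. by apply/dp_homP=> x; rewrite !ffunE. Qed.

Lemma dp_compm1 (A B : dposet) (f : dp_hom A B) : dp_comp f (dp_id A) = f.
Proof. by apply/dp_homP=> x; rewrite !ffunE. Qed.

Lemma dp_compA (A B C D : dposet)
    (h : dp_hom C D) (g : dp_hom B C) (f : dp_hom A B) :
  dp_comp h (dp_comp g f) = dp_comp (dp_comp h g) f.
Proof. by apply/dp_homP=> x; rewrite !ffunE. Qed.

Definition DPos : category := Category dp_comp1m dp_compm1 dp_compA.

(* Main.v *)
(** A coequalizer always lifts against a monomorphism, and an epimorphism
    against an equalizer, so only the factorizations of [f : A -> B] depend on
    the category.  Both go through the image of [f].  With the orders induced
    from [B], the inclusion of the image is the equalizer of two maps from [B]
    to two copies of [B], ordered by their first component, that agree exactly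
    on the image.  With the transitive closures of the images of the orders of
    [A], which are irreflexive because they are contained in the orders of [B],
    the projection onto the image is the coequalizer of the kernel pair of
    [f]. *)
From mathcomp Require Import all_boot.
Require Import Defs.

Set Implicit Arguments.
Unset Strict Implicit.
Unset Printing Implicit Defensive.

Local Open Scope cat_scope.

(** * Epimorphisms, monomorphisms and diagonals in an arbitrary category *)

Section Category.

Variable C : category.

Lemma coequalizer_epi (x a b : C) (p q : hom x a) (e : hom a b) :
  is_coequalizer p q e -> Epi e.
Proof.
move=> [epq ecoeq] y g h gh.
have [|u [_ uU]] := ecoeq y (g \c e); first by rewrite -!cmpA epq.
by rewrite -(uU g) // (uU h).
Qed.

Lemma equalizer_mono (a b x : C) (p q : hom b x) (m : hom a b) :
  is_equalizer p q m -> Mono m.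
Proof.
move=> [mpq meq] y g h gh.
have [|u [_ uU]] := meq y (m \c g); first by rewrite !cmpA mpq.
by rewrite -(uU g) // (uU h).
Qed.

Lemma Iso_epi (a b : C) (h : hom a b) : Iso h -> Epi h.
Proof.
by move=> [g [_ hg]] x u v uv; rewrite -(cmpm1 u) -(cmpm1 v) -hg !cmpA uv.
Qed.

Lemma Iso_mono (a b : C) (h : hom a b) : Iso h -> Mono h.
Proof.
by move=> [g [gh _]] x u v uv; rewrite -(cmp1m u) -(cmp1m v) -gh -!cmpA uv.
Qed.

Lemma Epi_comp (a b c : C) (g : hom b c) (f : hom a b) :
  Epi g -> Epi f -> Epi (g \c f).
Proof. by move=> gE fE x u v; rewrite !cmpA => /fE/gE. Qed.

Lemma Mono_comp (a b c : C) (g : hom b c) (f : hom a b) :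
  Mono g -> Mono f -> Mono (g \c f).
Proof. by move=> gM fM x u v; rewrite -!cmpA => /gM/fM. Qed.

Lemma Epi_iso_closed : iso_closed (@Epi C).
Proof.
by split=> a b c f h => [fE /Iso_epi hE|/Iso_epi fE hE]; apply: Epi_comp.
Qed.

Lemma Mono_iso_closed : iso_closed (@Mono C).
Proof.
by split=> a b c f h => [fM /Iso_mono hM|/Iso_mono fM hM]; apply: Mono_comp.
Qed.

Lemma RegEpi_iso_closed : iso_closed (@RegEpi C).
Proof.
split=> [a b c f h [x [p [q fcoeq]]] hI|a b c h f [h' [h'h hh']] [x [p [q fcoeq]]]].
- have hE := Iso_epi hI; have [h' [h'h hh']] := hI; have [fpq fU] := fcoeq.
  (* After [f], an isomorphism leaves the parallel pair unchanged; the factorization through [f] is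
     corrected by the inverse [h']. *)
  exists x, p, q; split=> [|y k /fU[u [uf _]]]; first by rewrite -!cmpA fpq.
  exists (u \c h'); split=> [|v vk].
    by rewrite -cmpA (cmpA h' h) h'h cmp1m.
  apply: (Epi_comp hE (coequalizer_epi fcoeq)).
  by rewrite vk -cmpA (cmpA h' h) h'h cmp1m.
- have [fpq fU] := fcoeq.
  (* Before [f], the pair has to be moved along [h'] to the source of [h]. *)
  exists x, (h' \c p), (h' \c q).
  split=> [|y k]; first by rewrite -!cmpA !(cmpA h h') hh' !cmp1m.
  rewrite !cmpA => /fU[u [uf _]].
  exists u; split=> [|v vk]; first by rewrite cmpA uf -cmpA h'h cmpm1.
  apply: (coequalizer_epi fcoeq).
  by rewrite uf -vk -!cmpA hh' cmpm1.
Qed.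

Lemma RegMono_iso_closed : iso_closed (@RegMono C).
Proof.
split=> [a b c f h [x [p [q feq]]] [h' [h'h hh']]|a b c h f hI [x [p [q feq]]]].
- have [fpq fU] := feq.
  exists x, (p \c h'), (q \c h').
  split=> [|y k]; first by rewrite -!cmpA !(cmpA h' h) h'h !cmp1m.
  rewrite -!cmpA => /fU[u [fu _]].
  exists u; split=> [|v vk]; first by rewrite -cmpA fu cmpA hh' cmp1m.
  apply: (equalizer_mono feq).
  by rewrite fu -vk !cmpA h'h cmp1m.
- have hM := Iso_mono hI; have [h' [h'h hh']] := hI; have [fpq fU] := feq.
  exists x, p, q; split=> [|y k /fU[u [fu _]]]; first by rewrite !cmpA fpq.
  exists (h' \c u); split=> [|v vk].
    by rewrite -cmpA (cmpA h h') hh' cmp1m.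
  apply: (Mono_comp (equalizer_mono feq) hM).
  by rewrite vk -cmpA (cmpA h h') hh' cmp1m.
Qed.

(** Cancelling [m] in [m f p = g e p = g e q = m f q] shows that [f] coequalizes the pair of [e],
    hence factors through [e]. The other triangle follows since [e] is epi. The next lemma is
    dual. *)
Lemma RegEpi_Mono_unique_diagonals :
  has_unique_diagonals (@RegEpi C) (@Mono C).
Proof.
move=> a b c d e m f g [x [p [q ecoeq]]] mM sq; have [epq eU] := ecoeq.
have [|k [ke kU]] := eU c f.
  by apply: mM; rewrite !cmpA -sq -!cmpA epq.
exists k; split=> [|k' [k'e _]]; last exact: kU.
by split=> //; apply: (coequalizer_epi ecoeq); rewrite -cmpA ke.
Qed.

Lemma Epi_RegMono_unique_diagonals :
  has_unique_diagonals (@Epi C) (@RegMono C).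
Proof.
move=> a b c d e m f g eE [x [p [q meq]]] sq; have [mpq mU] := meq.
have [|k [mk kU]] := mU b g.
  by apply: eE; rewrite -!cmpA sq !cmpA mpq.
exists k; split=> [|k' [_ mk']]; last exact: kU.
by split=> //; apply: (equalizer_mono meq); rewrite cmpA mk.
Qed.

End Category.

(** * Transitive closure of a relation on a finite type *)

Section TransitiveClosure.

Variables (T : finType) (R : rel T).

(** [connect] is reflexive, so one explicit [R]-step is put in front of it; otherwise the closure
    could never be irreflexive. *)
Definition tclosure : rel T := fun x y => [exists z, R x z && connect R z y].

Lemma tclosure_sub : subrel R tclosure.
Proof. by move=> x y xy; apply/existsP; exists y; rewrite xy /=. Qed.

Lemma tclosure_trans : transitive tclosure.
Proof.
move=> y x z /existsP[u /andP[xu uy]] /existsP[v /andP[yv vz]].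
apply/existsP; exists u; rewrite xu /=.
exact: connect_trans uy (connect_trans (connect1 yv) vz).
Qed.

Lemma tclosure_homo (U : Type) (S : rel U) (h : T -> U) :
    transitive S -> {homo h : x y / R x y >-> S x y} ->
  {homo h : x y / tclosure x y >-> S x y}.
Proof.
move=> S_tr hR x y /existsP[z /andP[+ /connectP[s]]].
elim: s x z => [|w s IHs] x z xz /= => [_ ->|/andP[zw ws] yE]; first exact: hR.
by apply: S_tr (hR _ _ xz) (IHs _ _ zw ws yE).
Qed.

End TransitiveClosure.

(** * Pullback and intersection of strict orders *)

Lemma strict_order_relpre (T U : Type) (h : T -> U) (R : rel U) :
  strict_order R -> strict_order (relpre h R).
Proof.
by move=> [R_irr R_tr]; split=> [x|y x z]; [apply: R_irr|apply: R_tr].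
Qed.

Lemma strict_orderI (T : Type) (R S : rel T) :
  strict_order R -> strict_order S -> strict_order [rel x y | R x y && S x y].
Proof.
move=> [R_irr R_tr] [_ S_tr]; split=> [x|y x z] /=; first by rewrite R_irr.
by move=> /andP[/R_tr Rxy /S_tr Sxy] /andP[/Rxy -> /Sxy ->].
Qed.

(** * Morphisms of double posets and embeddings *)

Section DoublePosets.

Implicit Types A B X : dposet.

Definition dp_homo A B (f : A -> B) :=
  {homo f : x y / dp_ltP x y} /\ {homo f : x y / dp_ltQ x y}.

Lemma dp_hom_homo A B (f : dp_hom A B) : dp_homo f.
Proof. exact/dp_monotoneP/dp_funP. Qed.

Lemma dp_hom_of_subproof A B (f : A -> B) :
  dp_homo f -> dp_monotone [ffun x => f x].
Proof.
by move=> [fP fQ]; apply/dp_monotoneP; split=> x y; rewrite !ffunE;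
  [apply: fP|apply: fQ].
Qed.

Definition dp_hom_of A B (f : A -> B) (f_homo : dp_homo f) : dp_hom A B :=
  DPHom (dp_hom_of_subproof f_homo).

Lemma dp_hom_ofE A B (f : A -> B) (f_homo : dp_homo f) :
  dp_hom_of f_homo =1 f.
Proof. by move=> x; rewrite ffunE. Qed.

Lemma dp_compE A B X (g : dp_hom B X) (f : dp_hom A B) x :
  dp_comp g f x = g (f x).
Proof. by rewrite ffunE. Qed.

Lemma dp_compP A A' B X (g : dp_hom A X) (f : dp_hom B A)
    (g' : dp_hom A' X) (f' : dp_hom B A') :
  dp_comp g f = dp_comp g' f' <-> forall x, g (f x) = g' (f' x).
Proof.
split=> [/dp_homP E x|E]; first by have := E x; rewrite !dp_compE.
by apply/dp_homP=> x; rewrite !dp_compE.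
Qed.

Lemma injective_Mono A B (f : dp_hom A B) :
  injective f -> Mono (f : @hom DPos A B).
Proof.
by move=> f_inj X g h /dp_compP E; apply/dp_homP=> x; apply/f_inj/E.
Qed.

Lemma surjective_Epi A B (f : dp_hom A B) :
  (forall y, exists x, f x = y) -> Epi (f : @hom DPos A B).
Proof.
move=> f_sur X g h /dp_compP E; apply/dp_homP=> y.
by have [x <-] := f_sur y; apply: E.
Qed.

(** The initial structure along [h]. As [h] need not be injective, it serves both for subsets of [B]
    and for two copies of [B]. *)
Definition dp_pre (T : finType) B (h : T -> B) : dposet :=
  DPoset (strict_order_relpre h (dp_ltP_strict B))
         (strict_order_relpre h (dp_ltQ_strict B)).

Lemma dp_pre_homo (T : finType) B (h : T -> B) : dp_homo (h : dp_pre h -> B).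
Proof. by split. Qed.

Lemma embedding_RegMono A B (f : dp_hom A B) :
    injective f ->
    (forall x y, dp_ltP (f x) (f y) -> dp_ltP x y) ->
    (forall x y, dp_ltQ (f x) (f y) -> dp_ltQ x y) ->
  RegMono (f : @hom DPos A B).
Proof.
move=> f_inj fP fQ.
(* The points [(y, true)] and [(y, false)] are incomparable, and the tag does not affect the orders,
   so every choice of tags gives a monotone section of [fst]. *)
pose X := dp_pre (fst : B * bool -> B).
have g_homo : @dp_homo B X (fun y => (y, true)) by split.
have h_homo : @dp_homo B X (fun y => (y, y \in codom f)) by split.
exists X, (dp_hom_of g_homo), (dp_hom_of h_homo); split.
  by apply/dp_compP=> x; rewrite !dp_hom_ofE codom_f.
move=> Y k /dp_compP E.
have kf y : k y \in codom f by have := E y; rewrite !dp_hom_ofE => -[<-].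
have [kP kQ] := dp_hom_homo k.
(* The preimages chosen by [iinv] depend monotonically on [y] because [f] reflects both orders. *)
have u_homo : @dp_homo Y A (fun y => iinv (kf y)).
  by split=> x y xy; [apply: fP|apply: fQ]; rewrite !f_iinv; [apply: kP|apply: kQ].
have uE : dp_comp f (dp_hom_of u_homo) = k.
  by apply/dp_homP=> y; rewrite dp_compE dp_hom_ofE f_iinv.
exists (dp_hom_of u_homo); split=> // v vE.
by apply: (injective_Mono f_inj); apply: etrans uE (esym vE).
Qed.

(** * The two factorizations of [f] through its image *)

Section Image.

Variables (A B : dposet) (f : dp_hom A B).

Definition image : finType := {y : B | y \in codom f}.

Definition to_image (x : A) : image := Sub (f x) (codom_f f x).

Lemma to_image_iinv (y : image) : to_image (iinv (valP y)) = y.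
Proof. by apply: val_inj; rewrite /= f_iinv. Qed.

Lemma dp_Epi_RegMono_factorization :
  exists (I : dposet) (e : dp_hom A I) (m : dp_hom I B),
    [/\ Epi (e : @hom DPos A I), RegMono (m : @hom DPos I B)
      & f = dp_comp m e].
Proof.
pose I := dp_pre (val : image -> B).
have e_homo : @dp_homo A I to_image by exact: dp_hom_homo.
have m_homo : @dp_homo I B val by exact: dp_pre_homo.
exists I, (dp_hom_of e_homo), (dp_hom_of m_homo); split.
- apply: surjective_Epi => y; exists (iinv (valP y)).
  by rewrite dp_hom_ofE to_image_iinv.
- apply: embedding_RegMono => x y; rewrite !dp_hom_ofE //.
  exact: val_inj.
- by apply/dp_homP=> x; rewrite dp_compE !dp_hom_ofE.
Qed.

Definition image_rel (R : rel A) : rel image := fun y z =>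
  [exists x, exists x', [&& R x x', to_image x == y & to_image x' == z]].

Lemma image_relP (R : rel A) y z :
  reflect (exists x x', [/\ R x x', to_image x = y & to_image x' = z])
          (image_rel R y z).
Proof.
apply: (iffP existsP) => [[x /existsP[x' /and3P[xx' /eqP <- /eqP <-]]]|].
  by exists x, x'.
by move=> [x [x' [xx' <- <-]]]; exists x; apply/existsP; exists x'; rewrite xx' !eqxx.
Qed.

(** Even for transitive [R], [image_rel R] may fail to be transitive: two consecutive pairs may meet
    only in distinct points of one fibre of [f]. *)
Definition image_order (R : rel A) : rel image := tclosure (image_rel R).

Lemma to_image_homo (R : rel A) :
  {homo to_image : x y / R x y >-> image_order R x y}.
Proof. by move=> x y xy; apply/tclosure_sub/image_relP; exists x, y. Qed.

Lemma image_order_homo (R : rel A) (U : Type) (S : rel U) (h : image -> U) :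
    transitive S -> {homo h \o to_image : x y / R x y >-> S x y} ->
  {homo h : y z / image_order R y z >-> S y z}.
Proof.
move=> S_tr hR; apply: tclosure_homo => // y z.
by move=> /image_relP[x [x' [xx' <- <-]]]; apply: hR.
Qed.

Lemma image_order_strict (R : rel A) (S : rel B) :
    strict_order S -> {homo f : x y / R x y >-> S x y} ->
  strict_order (image_order R).
Proof.
move=> [S_irr S_tr] fR; split=> [y|]; last exact: tclosure_trans.
apply: contraFF (S_irr (val y)) => yy.
exact: (image_order_homo (h := val) S_tr fR).
Qed.

Definition coimage : dposet :=
  DPoset (image_order_strict (dp_ltP_strict B) (dp_hom_homo f).1)
         (image_order_strict (dp_ltQ_strict B) (dp_hom_homo f).2).

Lemma to_coimage_homo : @dp_homo A coimage to_image.
Proof. by split; apply: to_image_homo. Qed.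

(** The final structure along [to_image], dual to [dp_pre]. It yields monotonicity both of the
    inclusion into [B] and of the maps induced by the coequalizer property. *)
Lemma coimage_homo X (h : coimage -> X) :
  @dp_homo A X (h \o to_image) -> dp_homo h.
Proof.
by move=> [hP hQ]; split; apply: image_order_homo => //;
  [apply: (dp_ltP_strict X).2|apply: (dp_ltQ_strict X).2].
Qed.

Lemma to_coimage_RegEpi :
  RegEpi (dp_hom_of to_coimage_homo : @hom DPos A coimage).
Proof.
pose K : finType := {p : A * A | f p.1 == f p.2}.
pose fstK (p : K) := (val p).1; pose sndK (p : K) := (val p).2.
(* The kernel pair of [f], with the componentwise orders inherited from the product. *)
pose X := DPoset
  (strict_orderI (strict_order_relpre fstK (dp_ltP_strict A))
                 (strict_order_relpre sndK (dp_ltP_strict A)))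
  (strict_orderI (strict_order_relpre fstK (dp_ltQ_strict A))
                 (strict_order_relpre sndK (dp_ltQ_strict A))).
have p_homo : @dp_homo X A fstK by split=> x y /andP[].
have q_homo : @dp_homo X A sndK by split=> x y /andP[].
exists X, (dp_hom_of p_homo), (dp_hom_of q_homo); split.
  apply/dp_compP=> x; rewrite !dp_hom_ofE.
  exact/val_inj/eqP/(valP x).
move=> Y k /dp_compP E.
have kE x y : f x = f y -> k x = k y.
  move=> /eqP xy; have := E (Sub (x, y) xy : K).
  by rewrite !dp_hom_ofE.
(* By [kE], [k] is constant on the fibres of [f], so the chosen preimage is immaterial. *)
pose u (y : coimage) := k (iinv (valP y)).
have ue x : u (to_image x) = k x by apply: kE; rewrite f_iinv.
have u_homo : dp_homo u.
  have [kP kQ] := dp_hom_homo k.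
  by apply: coimage_homo; split=> x y xy; rewrite /= !ue; [apply: kP|apply: kQ].
exists (dp_hom_of u_homo); split=> [|v /dp_homP vE].
  by apply/dp_homP=> x; rewrite dp_compE !dp_hom_ofE ue.
apply/dp_homP=> y; rewrite dp_hom_ofE -(to_image_iinv y) ue -vE dp_compE.
by rewrite dp_hom_ofE.
Qed.

Lemma dp_RegEpi_Mono_factorization :
  exists (I : dposet) (e : dp_hom A I) (m : dp_hom I B),
    [/\ RegEpi (e : @hom DPos A I), Mono (m : @hom DPos I B)
      & f = dp_comp m e].
Proof.
have m_homo : @dp_homo coimage B val by apply: coimage_homo; apply: dp_hom_homo.
exists coimage, (dp_hom_of to_coimage_homo), (dp_hom_of m_homo); split.
- exact: to_coimage_RegEpi.
- by apply: injective_Mono => x y; rewrite !dp_hom_ofE; apply: val_inj.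
- by apply/dp_homP=> x; rewrite dp_compE !dp_hom_ofE.
Qed.

End Image.

End DoublePosets.

Theorem theoremB11 :
  structured (@RegEpi DPos) (@Mono DPos) /\
  structured (@Epi DPos) (@RegMono DPos).
Proof.
split; split.
- by split; [apply: RegEpi_iso_closed|apply: Mono_iso_closed].
- by move=> A B f; apply: dp_RegEpi_Mono_factorization.
- exact: RegEpi_Mono_unique_diagonals.
- by split; [apply: Epi_iso_closed|apply: RegMono_iso_closed].
- by move=> A B f; apply: dp_Epi_RegMono_factorization.
- exact: Epi_RegMono_unique_diagonals.
Qed.
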